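(* Let $A$ be a finite-dimensional commutative algebra over a field of characteristic zero which is associative or alternative, let $\mathrm{Rad}(A)$ be its (Jacobson) radical, and let $R$ be a Rota–Baxter operator of weight zero on $A$. Then (a) $\mathrm{Im}\,R\subseteq \mathrm{Rad}(A)$; (b) if $A$ is unital, then $\mathrm{rb}(A)\le 2m-1$, where $m$ is the nilpotency index of $\mathrm{Rad}(A)$ (the least $m$ with $\mathrm{Rad}(A)^m=0$).
   Context: A linear operator $R$ on $A$ is a Rota–Baxter operator of weight $0$ if $R(x)R(y)=R(R(x)y+xR(y))$ for all $x,y\in A$. For finite-dimensional associative or alternative $A$, $\mathrm{Rad}(A)$ is the largest nilpotent ideal. The RB-index $\mathrm{rb}(A)$ is the least $n\in\mathbb N$ such that $R^n=0$ for every Rota–Baxter operator $R$ of weight zero on $A$ ($\infty$ if no such $n$ exists). *)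

(* Defs.v *)
(* A (possibly non-associative) finite-dimensional algebra
   over a field K is modelled as a vector space V : vectType K together with
   a bilinear multiplication mul : V -> V -> V. *)
From HB Require Import structures.
From mathcomp Require Import all_boot all_order all_algebra.
Set Implicit Arguments. Unset Strict Implicit. Unset Printing Implicit Defensive.
Import GRing.Theory.
Local Open Scope ring_scope.

Section NonAssocAlgebra.
Variables (K : fieldType) (V : vectType K) (mul : V -> V -> V).

Definition bilinear_mul : Prop :=
  (forall x, linear (mul x)) /\ (forall y, linear (fun x => mul x y)).

Definition commutative_mul : Prop := forall x y, mul x y = mul y x.

Definition associative_mul : Prop :=
  forall x y z, mul (mul x y) z = mul x (mul y z).

Definition alternative_mul : Prop :=
  forall x y, mul x (mul x y) = mul (mul x x) y /\ mul (mul y x) x = mul y (mul x x).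

Definition unital_mul : Prop := exists e : V, forall x, mul e x = x /\ mul x e = x.

(* product U*W of subspaces: the span of all products u*w, u in U, w in W *)
Definition prodv (U W : {vspace V}) : {vspace V} :=
  (<<[seq mul u w | u <- vbasis U, w <- vbasis W]>>)%VS.

Definition is_ideal (I : {vspace V}) : Prop :=
  forall x y, y \in I -> (mul x y \in I) /\ (mul y x \in I).

(* powers of a subspace in the non-associative sense:
   I^1 = I,  I^n = sum_{1 <= i < n} I^i I^(n-i)  (n >= 2),
   i.e. I^n is spanned by all products of n elements of I in any bracketing.
   Implemented with fuel; vpow I n is correct for n >= 1 (vpow I 0 = 0). *)
Fixpoint vpow_aux (I : {vspace V}) (f n : nat) : {vspace V} :=
  match f with
  | 0 => 0%VS
  | f'.+1 => if n == 1%N then I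
             else (\sum_(1 <= i < n) prodv (vpow_aux I f' i) (vpow_aux I f' (n - i)))%VS
  end.

Definition vpow (I : {vspace V}) (n : nat) : {vspace V} := vpow_aux I n n.

Definition nilpotent_ideal (I : {vspace V}) : Prop :=
  is_ideal I /\ exists n, (0 < n)%N /\ vpow I n = 0%VS.

Definition is_radical (N : {vspace V}) : Prop :=
  nilpotent_ideal N /\ forall J, nilpotent_ideal J -> (J <= N)%VS.

Definition is_RB0 (R : V -> V) : Prop :=
  linear R /\ forall x y, mul (R x) (R y) = R (mul (R x) y + mul x (R y)).

Definition rb_le (n : nat) : Prop :=
  forall R, is_RB0 R -> forall x, iter n R x = 0.

End NonAssocAlgebra.

(* Main.v *)
(** In characteristic different from 3 a commutative alternative algebra is
    associative: the associator is alternating, and commutativity makes its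
    cyclic sum vanish.

    (a) The image of [R] is a subalgebra without nonzero idempotents: if
    [e = R y] is idempotent, then [e = e e = 2 R (y e)], while
    [e = e (e e) = 3 R (y e)].  By the Fitting decomposition of the
    multiplication by [a] on the image of [R], a non-nilpotent [a] would produce
    a nonzero idempotent there.  So every [R x] is nilpotent, and generates a
    nilpotent ideal.

    (b) Put [a = R 1] and let [l] be the multiplication by [a].  The Rota-Baxter
    identity gives [[l, R^k] = k R^(k+1)], so [R^(2m-1)] is a combination of the
    maps [l^i R l^j] with [i + j = 2m - 2].  Each of them vanishes: either
    [j >= m] and [l^j = 0], or [i >= m - 1] and the image lies in [N^(i+1) = 0]. *)

Require Import Defs.
From HB Require Import structures.
From mathcomp Require Import all_boot all_order all_algebra.
From mathcomp Require Import zify.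
Import GRing.Theory.
Local Open Scope ring_scope.

Set Implicit Arguments.
Unset Strict Implicit.
Unset Printing Implicit Defensive.

(** * Bilinear products and powers of subspaces *)

Section BilinearMul.

Variables (K : fieldType) (V : vectType K) (mul : V -> V -> V).
Hypothesis mul_bil : bilinear_mul mul.

Lemma bmulDr x y z : mul x (y + z) = mul x y + mul x z.
Proof. by have := mul_bil.1 x 1 y z; rewrite !scale1r. Qed.

Lemma bmulDl x y z : mul (x + y) z = mul x z + mul y z.
Proof. by have := mul_bil.2 z 1 x y; rewrite !scale1r. Qed.

Lemma bmul0r x : mul x 0 = 0.
Proof. by apply: (@addIr _ (mul x 0)); rewrite -bmulDr !add0r. Qed.

Lemma bmul0l x : mul 0 x = 0.
Proof. by apply: (@addIr _ (mul 0 x)); rewrite -bmulDl !add0r. Qed.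

Lemma bmulZr c x y : mul x (c *: y) = c *: mul x y.
Proof. by have := mul_bil.1 x c y 0; rewrite !addr0 bmul0r addr0. Qed.

Lemma bmulZl c x y : mul (c *: x) y = c *: mul x y.
Proof. by have := mul_bil.2 y c x 0; rewrite !addr0 bmul0l addr0. Qed.

Definition lmulv (a : V) : 'End(V) :=
  linfun (HB.pack_for {linear V -> V} (mul a)
    (GRing.isLinear.Build K V V *:%R (mul a) (mul_bil.1 a))).

Lemma lmulvE a x : lmulv a x = mul a x.
Proof. by rewrite lfunE. Qed.

Lemma iter_lmulv0 a n : iter n (mul a) 0 = 0.
Proof. by elim: n => //= n ->; rewrite bmul0r. Qed.

Lemma iter_lmulvD a n x y :
  iter n (mul a) (x + y) = iter n (mul a) x + iter n (mul a) y.
Proof. by elim: n => //= n ->; rewrite bmulDr. Qed.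

Lemma iter_lmulvMn a n x k : iter n (mul a) (x *+ k) = iter n (mul a) x *+ k.
Proof.
by elim: k => [|k IHk]; rewrite ?mulr0n ?iter_lmulv0 // !mulrS iter_lmulvD IHk.
Qed.

Lemma prodv_subP (U W T : {vspace V}) :
  (forall u w, u \in U -> w \in W -> mul u w \in T) -> (prodv mul U W <= T)%VS.
Proof.
move=> UWT; apply/span_subvP => _ /allpairsP[[u w] [/= uU wW ->]].
by apply: UWT; apply: vbasis_mem.
Qed.

Lemma memv_prodv (U W : {vspace V}) u w :
  u \in U -> w \in W -> mul u w \in prodv mul U W.
Proof.
move=> uU wW; rewrite (coord_vbasis uU).
elim/big_ind: _ => [|x y xP yP|i _]; first by rewrite bmul0l mem0v.
  by rewrite bmulDl memvD.
rewrite bmulZl memvZ // (coord_vbasis wW).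
elim/big_ind: _ => [|x y xP yP|j _]; first by rewrite bmul0r mem0v.
  by rewrite bmulDr memvD.
rewrite bmulZr memvZ //; apply/memv_span/allpairsP.
by exists ((vbasis U)`_i, (vbasis W)`_j); split => //=;
  apply: mem_nth; rewrite size_tuple.
Qed.

Lemma vpow_lmul (I : {vspace V}) n a z :
  (0 < n)%N -> a \in I -> z \in vpow mul I n -> mul a z \in vpow mul I n.+1.
Proof.
case: n => // n _ aI zI; rewrite /vpow [vpow_aux _ _ n.+2 _]/=.
(* The summand [i = 1] is the product of [I] with the preceding power. *)
rewrite big_ltn //; apply: (subvP (addvSl _ _)).
by rewrite subSS subn0; apply: memv_prodv.
Qed.

Lemma vpow_iter_lmul (I : {vspace V}) n a z :
  a \in I -> z \in I -> iter n (mul a) z \in vpow mul I n.+1.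
Proof. by move=> aI zI; elim: n => //= n IHn; apply: vpow_lmul. Qed.

(** Bounds all bracketings at once, so nilpotency of an ideal can be read off a multiplicative
    filtration. *)
Lemma vpow_sub_filtration (I : {vspace V}) (T : nat -> {vspace V}) n :
    (I <= T 1%N)%VS ->
    (forall i j, (0 < i)%N -> (0 < j)%N ->
       forall u w, u \in T i -> w \in T j -> mul u w \in T (i + j)%N) ->
  (0 < n)%N -> (vpow mul I n <= T n)%VS.
Proof.
(* The fuel is separated from the exponent, and the bound is proved for any fuel: exhausted fuel
   gives 0. *)
move=> IT1 Tmul; rewrite /vpow; move: {2}n => f.
elim: f n => [|f IHf] n n_gt0 /=; first exact: sub0v.
case: eqP => [-> // | _]; rewrite big_seq.
elim/big_ind: _ => [|U W UT WT|i]; first exact: sub0v.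
  by rewrite subv_add UT.
rewrite mem_index_iota => /andP[i_gt0 ltin]; apply: prodv_subP => u w uU wW.
have dn_gt0 : (0 < n - i)%N by rewrite subn_gt0.
have -> : n = (i + (n - i))%N by rewrite subnKC // ltnW.
by apply: Tmul => //; [apply: subvP uU | apply: subvP wW]; apply: IHf.
Qed.

Lemma comm_alternative_assoc :
    3%:R != 0 :> K -> commutative_mul mul -> alternative_mul mul ->
  associative_mul mul.
Proof.
move=> nz3 mulC alt; pose as3 x y z := mul (mul x y) z - mul x (mul y z).
have as_xx x y : as3 x x y = 0 by rewrite /as3 (alt x y).1 subrr.
have asDl x x' y z : as3 (x + x') y z = as3 x y z + as3 x' y z.
  by rewrite /as3 !bmulDl opprD addrACA.
have asDm x y y' z : as3 x (y + y') z = as3 x y z + as3 x y' z.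
  by rewrite /as3 bmulDr !bmulDl bmulDr opprD addrACA.
have as_swap x y z : as3 y x z = - as3 x y z.
  apply/eqP; rewrite -addr_eq0; apply/eqP.
  by have := as_xx (x + y) z; rewrite asDl !asDm !as_xx add0r addr0 addrC.
have as_rev x y z : as3 z y x = - as3 x y z.
  by rewrite /as3 opprB (mulC _ x) (mulC z y) (mulC z) (mulC y x).
(* A rotation is a reversal followed by a swap, so the two signs cancel and [cyc] reads
   [3 as3 = 0]. *)
have as_rot x y z : as3 x y z = as3 y z x by rewrite as_rev as_swap opprK.
have cyc x y z : as3 x y z + as3 y z x + as3 z x y = 0.
  rewrite /as3 (mulC (mul y z)) (mulC (mul z x)) (mulC z (mul x y)).
  by rewrite !addrA !addrNK subrr.
move=> x y z; apply/eqP; rewrite -subr_eq0 -/(as3 x y z).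
have := cyc x y z; rewrite (as_rot z) -(as_rot x) => /eqP.
by rewrite -mulr2n -mulrSr -scaler_nat scaler_eq0 (negPf nz3).
Qed.

End BilinearMul.

(** * Nilpotent elements and idempotents *)

Section CommutativeAssociative.

Variables (K : fieldType) (V : vectType K) (mul : V -> V -> V).
Hypotheses (mul_bil : bilinear_mul mul) (mulC : commutative_mul mul).
Hypothesis mulA : associative_mul mul.

Let mulDr := bmulDr mul_bil.
Let mulDl := bmulDl mul_bil.
Let mul0r := bmul0r mul_bil.
Let mul0l := bmul0l mul_bil.
Let mulZr := bmulZr mul_bil.
Let mulZl := bmulZl mul_bil.

Lemma iter_mulA a n x y : iter n (mul a) (mul x y) = mul (iter n (mul a) x) y.
Proof. by elim: n => //= n ->; rewrite mulA. Qed.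

(** The power [a^n] for [n >= 1], without recourse to a unit; index 0 also yields [a]. *)
Let powA a n := iter n.-1 (mul a) a.

Lemma mul_powA a i j :
  (0 < i)%N -> (0 < j)%N -> mul (powA a i) (powA a j) = powA a (i + j).
Proof.
case: i j => [|i] [|j] // _ _; rewrite /powA /=.
by rewrite -iter_mulA -iterS -iterD.
Qed.

Lemma nilpotent_mem_radical (N : {vspace V}) a n :
  is_radical mul N -> iter n (mul a) a = 0 -> a \in N.
Proof.
move=> [_ maxN] an0.
(* [T k] is the ideal generated by [a^k]; the line through [a^k] is added because a unit may be
   missing. *)
pose T k := (<[powA a k]> + limg (lmulv mul_bil (powA a k)))%VS.
have TP k z : reflect (exists c b, z = c *: powA a k + mul (powA a k) b)
                      (z \in T k).
  apply: (iffP memv_addP) => [[_ /vlineP[c ->] [_ /memv_imgP[b _ ->] ->]]|].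
    by exists c, b; rewrite lmulvE.
  move=> [c [b ->]]; exists (c *: powA a k); first by rewrite memvZ ?memv_line.
  by exists (mul (powA a k) b) => //; rewrite -(lmulvE mul_bil) memv_img ?memvf.
have Tmul i j : (0 < i)%N -> (0 < j)%N ->
    forall u w, u \in T i -> w \in T j -> mul u w \in T (i + j)%N.
  move=> i0 j0 _ _ /TP[c [b ->]] /TP[d [b' ->]]; apply/TP.
  (* Read off from expanding [(c p + p b)(d q + q b')]. *)
  exists (c * d), (c *: b' + d *: b + mul b b').
  rewrite -(mul_powA a i0 j0); set p := powA a i; set q := powA a j.
  rewrite !(mulDl, mulDr, mulZl, mulZr) scalerDr scalerA -!addrA !mulA.
  by rewrite -(mulA b q) !(mulC b q) mulA.
have aT : a \in T 1%N.
  by apply/TP; exists 1, 0; rewrite mul0r scale1r addr0.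
suff /maxN/subvP : nilpotent_ideal mul (T 1%N) by apply.
split=> [x y /TP[c [b ->]]|].
  rewrite [mul _ x]mulC; suff: mul x (c *: a + mul a b) \in T 1%N by [].
  apply/TP; exists 0, (c *: x + mul b x).
  by rewrite scale0r add0r !mulDr !mulZr (mulC x a) (mulC x) mulA.
exists n.+1; split=> //; apply/eqP; rewrite -subv0.
have := vpow_sub_filtration (n := n.+1) (subvv _) Tmul isT.
move/subv_trans; apply; apply/subvP => z /TP[c [b ->]].
by rewrite /powA /= an0 mul0l scaler0 addr0 mem0v.
Qed.

(** The images [U k] of [B] under powers of [l] stabilise at some [U n], where [l] is bijective. If
    [a^(n+1)] is nonzero, the solution [e] in [U n] of [a^(n+1) e = a^(n+1)] is the idempotent. *)
Lemma nilpotent_or_idempotent (B : {vspace V}) a :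
    (forall x y, x \in B -> y \in B -> mul x y \in B) -> a \in B ->
  (exists n, iter n (mul a) a = 0) \/
  (exists e, [/\ e \in B, e != 0 & mul e e = e]).
Proof.
move=> BM aB; pose l := lmulv mul_bil a.
pose U k := iter k (fun W => l @: W)%VS B.
have leU k : (U k.+1 <= U k)%VS.
  elim: k => [|k IHk]; last exact: limgS.
  by apply/subvP => _ /memv_imgP[x xB ->]; rewrite lmulvE BM.
have [n dimU] : exists n, \dim (U n.+1) = \dim (U n).
  have [/existsP[n /eqP]|] := boolP
    [exists n : 'I_(\dim B).+1, \dim (U n.+1) == \dim (U n)]; first by exists n.
  rewrite negb_exists => /forallP dimU.
  (* A strict drop at each of [\dim B + 1] steps would exceed the available dimension. *)
  have le_dim k : (k <= (\dim B).+1)%N -> (\dim (U k) + k <= \dim B)%N.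
    elim: k => [|k IHk] ltk; first by rewrite addn0.
    apply: leq_trans (IHk (ltnW ltk)); rewrite addnS ltn_add2r.
    by rewrite ltn_neqAle (dimU (Ordinal ltk)) dimvS.
  by have := le_dim _ (leqnn _); rewrite addnS ltnNge leq_addl.
have defU : (l @: U n = U n)%VS.
  by apply/eqP; rewrite eqEdim leU [X in (_ <= X)%N]dimU leqnn.
have inj_l x y : x \in U n -> y \in U n -> mul a x = mul a y -> x = y.
  move=> xU yU axy; apply/eqP; rewrite -subr_eq0 -memv0.
  suff <- : (U n :&: lker l = 0)%VS.
    by rewrite memv_cap memvB // memv_ker linearB /= !lmulvE axy subrr.
  by apply/eqP; rewrite -dimv_eq0 -(eqn_add2r (\dim (l @: U n))) limg_ker_dim defU.
have surj_l x : x \in U n -> exists2 y, y \in U n & x = mul a y.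
  by rewrite -{1}defU => /memv_imgP[y yU ->]; exists y; rewrite ?lmulvE.
have UB k : (U k <= B)%VS.
  by elim: k => // k; apply: subv_trans (leU k).
have memU k x : x \in B -> iter k (mul a) x \in U k.
  by move=> xB; elim: k => //= k IHk; rewrite -(lmulvE mul_bil) memv_img.
(* [U n] absorbs [B], since [(a^n z) y = a^n (z y)]. *)
have UM x y : x \in U n -> y \in B -> mul x y \in U n.
  move=> xU yB; have [z zB ->] : exists2 z, z \in B & x = iter n (mul a) z.
    elim: (n) x xU => [|k IHk] x; first by exists x.
    by move=> /memv_imgP[x' /IHk[z zB ->] ->]; exists z; rewrite ?lmulvE.
  by rewrite -iter_mulA memU // BM.
have surj_iter k x : x \in U n -> exists2 y, y \in U n & x = iter k (mul a) y.
  elim: k x => [|k IHk] x; first by exists x.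
  by move=> /surj_l[y /IHk[z zU ->] ->]; exists z.
have inj_iter k x y : x \in U n -> y \in U n ->
    iter k (mul a) x = iter k (mul a) y -> x = y.
  elim: k x y => //= k IHk x y xU yU; rewrite -!iterS !iterSr => axy.
  by apply: inj_l => //; apply: IHk axy; rewrite mulC UM.
have [e eU ec] := surj_iter n.+1 _ (memU n a aB).
have [an0 | an0] := eqVneq (iter n (mul a) a) 0; [by left; exists n | right].
exists e; split; first exact: subvP (UB n) _ eU.
  by apply: contraNneq an0 => e0; rewrite ec e0 iter_lmulv0.
have eeU : mul e e \in U n by rewrite UM // (subvP (UB n)).
(* Both [e e] and [e] are sent to [a^(n+1)] by [l^(n+1)]. *)
apply: inj_iter n.+1 _ _ eeU eU _.
by rewrite iter_mulA -ec -iter_mulA -iterSr.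
Qed.

(** * Rota-Baxter operators of weight zero *)

Section RotaBaxter.

Variable R : {linear V -> V}.
Hypothesis RB : forall x y, mul (R x) (R y) = R (mul (R x) y + mul x (R y)).

Lemma rota_baxter_idempotent (y : V) :
  mul (R y) (R y) = R y -> R y = 0.
Proof.
move def_e: (R y) => e ee.
have e2 : e = R (mul e y) *+ 2.
  by rewrite -[LHS]ee -def_e RB def_e (mulC y) linearD -mulr2n.
have e3 : e = R (mul e y) *+ 3.
  have eh : mul e (R (mul e y)) = R (mul e y) + R (mul y (R (mul e y))).
    by rewrite -linearD -{1}def_e RB def_e -mulA ee.
  (* Replacing one factor of [e e] by [2 R (e y)] gives [2 R (e y) + R (y (2 R (e y)))], whose last
     term is [R (y e)]. *)
  rewrite -[LHS]ee {2}e2 mulr2n mulDr eh addrACA.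
  rewrite -[R (mul y _) + _]linearD -mulDr -!mulr2n -{2}e2.
  by rewrite (mulC y) -mulrSr.
have := e3; rewrite mulrS -e2 -{1}[e]add0r => /addIr re0.
by rewrite e2 -re0 mul0rn.
Qed.

Lemma rota_baxter_image_nilpotent x :
  exists n, iter n (mul (R x)) (R x) = 0.
Proof.
pose f := linfun R.
have Rim y : R y \in limg f by rewrite -(lfunE R) memv_img ?memvf.
have imM u v : u \in limg f -> v \in limg f -> mul u v \in limg f.
  by move=> /memv_imgP[y _ ->] /memv_imgP[z _ ->]; rewrite !lfunE /= RB Rim.
have [//|[e [/memv_imgP[y _ ->]]]] := nilpotent_or_idempotent imM (Rim x).
by rewrite lfunE /= => /eqP nz /rota_baxter_idempotent.
Qed.

Lemma rota_baxter_image_radical (N : {vspace V}) x :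
  is_radical mul N -> R x \in N.
Proof.
move=> radN; have [n Rxn0] := rota_baxter_image_nilpotent x.
exact: nilpotent_mem_radical Rxn0.
Qed.

(** Moving [R e] past one [R] costs one extra [R], because [e] acts as the identity. *)
Lemma rota_baxter_unit_commutator e k y : (forall z, mul e z = z) ->
  mul (R e) (iter k R y) = iter k R (mul (R e) y) + iter k.+1 R y *+ k.
Proof.
move=> e1; elim: k => [|k IHk] /=; first by rewrite mulr0n addr0.
by rewrite RB e1 IHk !linearD linearMn /= -addrA -mulrSr.
Qed.

Lemma rota_baxter_iter_eq0 (N : {vspace V}) m x :
    [pchar K] =i pred0 -> is_radical mul N -> unital_mul mul ->
    (0 < m)%N -> vpow mul N m = 0%VS ->
  iter (2 * m - 1) R x = 0.
Proof.
move=> charK radN [e e1] m_gt0 Nm0.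
have eK z : mul e z = z by have [] := e1 z.
pose a := R e; have RN z : R z \in N by apply: rota_baxter_image_radical.
have iterN i z : (m.-1 <= i)%N -> z \in N -> iter i (mul a) z = 0.
  move=> le_mi zN; rewrite -(subnK le_mi) iterD.
  have := vpow_iter_lmul mul_bil m.-1 (RN e) zN.
  by rewrite prednK // Nm0 memv0 => /eqP->; apply: iter_lmulv0.
(* Outside [N] one more factor is required: writing [z = e z] turns [l^j z] into [a^j z], with [a^j]
   in [N^j]. *)
have iterV j z : (m <= j)%N -> iter j (mul a) z = 0.
  case: j => [|j] le_mj; first by rewrite leqNgt m_gt0 in le_mj.
  rewrite -[z]eK iter_mulA iterSr [mul a e]mulC eK iterN ?RN ?mul0l //.
  by rewrite -ltnS prednK.
(* Induction on [k] replaces an explicit expansion: the commutator writes [(k+1) l^i R^(k+2) l^j] as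
   a difference of two terms with one [R] fewer and one [l] more, and [k+1] is invertible in
   characteristic zero. *)
have vanish k : forall i j z, (2 * m - 2 <= i + j + k)%N ->
    iter i (mul a) (iter k.+1 R (iter j (mul a) z)) = 0.
  elim: k => [|k IHk] i j z le_ijk.
    have [le_mj | lt_jm] := leqP m j.
      by rewrite (iterV j) //= linear0 iter_lmulv0.
    apply: iterN (RN _); rewrite addn0 in le_ijk.
    by lia.
  have := congr1 (iter i (mul a))
    (rota_baxter_unit_commutator k.+1 (iter j (mul a) z) eK).
  rewrite -/a -(iterSr i) -[mul a (iter j _ z)]/(iter j.+1 (mul a) z).
  rewrite iter_lmulvD // iter_lmulvMn // (IHk i.+1); last by lia.
  rewrite (IHk i j.+1); last by lia.
  rewrite add0r => /esym/eqP; rewrite -scaler_nat scaler_eq0.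
  by rewrite (pcharf0P K).1 //= => /eqP.
have -> : (2 * m - 1)%N = (2 * m - 2).+1 by lia.
exact: (vanish (2 * m - 2)%N 0%N 0%N x).
Qed.

End RotaBaxter.

End CommutativeAssociative.

Theorem theorem13 (K : fieldType) (hK : [pchar K] =i pred0)
    (V : vectType K) (mul : V -> V -> V)
    (hbil : bilinear_mul mul) (hcomm : commutative_mul mul)
    (hassoc_or_alt : associative_mul mul \/ alternative_mul mul)
    (N : {vspace V}) (hN : is_radical mul N) :
  (forall R : V -> V, is_RB0 mul R -> forall x, R x \in N) /\
  (unital_mul mul ->
   forall m : nat, (0 < m)%N -> vpow mul N m = 0%VS ->
     (forall k : nat, (0 < k < m)%N -> vpow mul N k <> 0%VS) ->
     rb_le mul (2 * m - 1)).
Proof.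
have mulA : associative_mul mul.
  case: hassoc_or_alt => // /comm_alternative_assoc; apply=> //.
  by rewrite (pcharf0P K).1.
(* [is_RB0] states linearity as a proposition; the lemmas expect a bundled linear map. *)
pose lin R (linR : linear R) := HB.pack_for {linear V -> V} R
  (GRing.isLinear.Build K V V *:%R R linR).
split=> [R [linR RB] x | hunit m m_gt0 Nm0 _ R [linR RB] x].
  exact: (rota_baxter_image_radical hbil hcomm mulA (R := lin R linR) RB x hN).
exact: (rota_baxter_iter_eq0 hbil hcomm mulA (R := lin R linR) RB x hK hN).
Qed.
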